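(* For every constant $\varepsilon>0$, there exists a constant $c>1$ such that for every large enough $n$ there exists a function $\mathsf{anmExt}:\{0,1\}^n\to\{0,1\}$ such that for any affine source $X$ on $\{0,1\}^n$ of entropy at least $k\ge c\log n$ and any affine function $\mathcal{A}:\{0,1\}^n\to\{0,1\}^n$ without fixed points, it holds that $(\mathsf{anmExt}(X),\mathsf{anmExt}(\mathcal{A}(X)))\approx_\varepsilon (U_1,\mathsf{anmExt}(\mathcal{A}(X))).$
   Context: An affine source on $\{0,1\}^n=\mathbb{F}_2^n$ is the uniform distribution over an affine subspace of $\mathbb{F}_2^n$; its (min-)entropy is the dimension of that subspace. An affine function is a map $x\mapsto Mx+b$ over $\mathbb{F}_2$; it has no fixed points if $\mathcal{A}(x)\ne x$ for all $x$. $U_1$ is a uniform bit independent of $X$, and $A\approx_\varepsilon B$ means the statistical distance between $A$ and $B$ is at most $\varepsilon$. *)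

(* Defs.v *)
From mathcomp Require Import all_boot all_order all_algebra.
From mathcomp Require Import reals exp.

Set Implicit Arguments.
Unset Strict Implicit.
Unset Printing Implicit Defensive.

Import Order.TTheory GRing.Theory Num.Theory.
Local Open Scope ring_scope.

Record dist (R : realType) (T : finType) := Dist {
  pmf :> T -> R;
  pmf_ge0 : forall x, 0 <= pmf x;
  pmf_sum1 : \sum_x pmf x = 1 }.

Section Distributions.
Variable R : realType.

Section Map.
Variables (S T : finType) (f : S -> T) (P : dist R S).

Definition dmap_pmf (y : T) : R := \sum_(x | f x == y) P x.

Lemma dmap_ge0 y : 0 <= dmap_pmf y.
Proof. by apply: sumr_ge0 => x _; apply: pmf_ge0. Qed.

Lemma dmap_sum1 : \sum_y dmap_pmf y = 1.
Proof. by rewrite -(pmf_sum1 P) (partition_big f predT). Qed.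

Definition dmap : dist R T := Dist dmap_ge0 dmap_sum1.
End Map.

Section Prod.
Variables (S T : finType) (P : dist R S) (Q : dist R T).

Definition dprod_pmf (z : S * T) : R := P z.1 * Q z.2.

Lemma dprod_ge0 z : 0 <= dprod_pmf z.
Proof. by apply: mulr_ge0; apply: pmf_ge0. Qed.

Lemma dprod_sum1 : \sum_z dprod_pmf z = 1.
Proof.
rewrite -(pair_bigA _ (fun x y => P x * Q y)) /=.
rewrite -[RHS](pmf_sum1 P); apply: eq_bigr => x _.
by rewrite -mulr_sumr pmf_sum1 mulr1.
Qed.

Definition dprod : dist R (S * T)%type := Dist dprod_ge0 dprod_sum1.
End Prod.

Definition unif_bit_pmf (_ : 'F_2) : R := 2^-1.

Lemma unif_bit_ge0 b : 0 <= unif_bit_pmf b.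
Proof. by rewrite /unif_bit_pmf invr_ge0 ler0n. Qed.

Lemma unif_bit_sum1 : \sum_b unif_bit_pmf b = 1.
Proof.
by rewrite /unif_bit_pmf sumr_const card_Fp // -[LHS]mulr_natr mulVf // pnatr_eq0.
Qed.

Definition unif_bit : dist R 'F_2 := Dist unif_bit_ge0 unif_bit_sum1.

Definition uniform_over (T : finType) (P : dist R T) (A : {set T}) : Prop :=
  forall x, P x = if x \in A then #|A|%:R^-1 else 0.

Definition stat_dist (T : finType) (P Q : dist R T) : R :=
  2^-1 * \sum_x `|P x - Q x|.

Definition log2 (x : R) : R := ln x / ln 2.

End Distributions.

Section Affine.
Variable n : nat.

Definition affine_subspace (a : 'cV['F_2]_n) (V : {vspace 'cV['F_2]_n}) :
  {set 'cV['F_2]_n} := [set a + v | v in V].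

(* The entropy of an affine source is the dimension d of its support. *)
Definition affine_source (R : realType) (X : dist R 'cV['F_2]_n) (d : nat) :
    Prop :=
  exists (a : 'cV['F_2]_n) (V : {vspace 'cV['F_2]_n}),
    \dim V = d /\ uniform_over X (affine_subspace a V).

Definition affine_fun (A : 'cV['F_2]_n -> 'cV['F_2]_n) : Prop :=
  exists (M : 'M['F_2]_n) (b : 'cV['F_2]_n), forall x, A x = M *m x + b.

End Affine.

(* Main.v *)
(* Probabilistic method, for arbitrary families of sources and of adversaries.
   By the XOR lemma it suffices that the signs of f and of f + f \o h have small
   mean over every large set S of the family, for every fixed-point-free h.
   Such an h admits a proper 3-coloring c, that is c (h x) != c x for all x.  On
   a color class D of S the term f (h x) only reads f outside D, so adding
   f \o h to f on D only is an involution of the space of functions, and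
   f + f \o h is as random on D as f itself.  Hoeffding's bound then makes each
   test fail with probability exp (- Omega(#|S|)).  There are only 2^O(n^2)
   affine subspaces and affine maps, so a union bound over all tests succeeds as
   soon as #|S| >= n^4 with n large. *)
From HB Require Import structures.
Require Import Defs.
From mathcomp Require Import all_boot all_order all_algebra finfield.
From mathcomp Require Import boolp reals sequences exp.
From mathcomp Require Import zify ring lra.

Set Implicit Arguments.
Unset Strict Implicit.
Unset Printing Implicit Defensive.

Import Order.TTheory GRing.Theory Num.Theory.
Local Open Scope ring_scope.

Section Signs.
Variable R : numFieldType.
Implicit Types a b : 'F_2.

Definition F2_sign (b : 'F_2) : R := (-1) ^+ b.

Lemma F2_sign0 : F2_sign 0 = 1.
Proof. by []. Qed.

Lemma F2_sign1 : F2_sign 1 = -1.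
Proof. exact: expr1. Qed.

Lemma F2_eq0_or_1 b : b = 0 \/ b = 1.
Proof. by case: b => -[|[|[]]] // ?; [left | right]; apply: val_inj. Qed.

Lemma big_F2 (V : nmodType) (F : 'F_2 -> V) : \sum_b F b = F 0 + F 1.
Proof.
by rewrite !big_ord_recl big_ord0 addr0; congr (F _ + F _); apply: val_inj.
Qed.

Lemma addrr_F2 b : b + b = 0.
Proof. exact/addrr_pchar2/pchar_Fp. Qed.

Lemma F2_signD a b : F2_sign (a + b) = F2_sign a * F2_sign b.
Proof.
case: (F2_eq0_or_1 a) (F2_eq0_or_1 b) => -> [] ->.
- by rewrite addr0 F2_sign0 mulr1.
- by rewrite add0r F2_sign0 mul1r.
- by rewrite addr0 F2_sign0 mulr1.
- by rewrite addrr_F2 F2_sign0 F2_sign1 mulrNN mulr1.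
Qed.

Lemma normr_F2_sign b : `|F2_sign b| = 1.
Proof. by rewrite normrX normrN1 expr1n. Qed.

Lemma eq_F2E a b : (a == b)%:R = (1 + F2_sign (a + b)) / 2.
Proof.
have [->|ab] := eqVneq a b; first by rewrite addrr_F2 F2_sign0 -[LHS]/1; field.
suff -> : a + b = 1 by rewrite F2_sign1 subrr mul0r.
by move: ab; case: (F2_eq0_or_1 a) (F2_eq0_or_1 b) => -> [] ->;
  rewrite ?eqxx // ?add0r ?addr0.
Qed.

End Signs.

Lemma dmapE (R : realType) (S T : finType) (f : S -> T) (P : dist R S) y :
  dmap f P y = \sum_x P x * (f x == y)%:R.
Proof.
by rewrite [LHS]big_mkcond; apply: eq_bigr => x _; rewrite mulr_natr mulrb.
Qed.

Section SignSums.
Variables (R : numFieldType) (T : finType).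
Implicit Types (D : {set T}) (f : T -> 'F_2).

Definition sign_sum D f : R := \sum_(x in D) F2_sign R (f x).

Lemma normr_sign_sum_le_classes (U : finType) (c : T -> U) D f (e : R) :
  (forall u, `|sign_sum [set x in D | c x == u] f| <= e) ->
  `|sign_sum D f| <= #|U|%:R * e.
Proof.
move=> class_le; rewrite /sign_sum (partition_big c predT) //=.
apply: le_trans (ler_norm_sum _ _ _) _.
rewrite mulr_natl -sumr_const; apply: ler_sum => u _.
rewrite (eq_bigl (mem [set x in D | c x == u])); first exact: class_le.
by move=> x; rewrite /= inE.
Qed.

End SignSums.

Section StatisticalDistance.
Variables (R : realType) (T : finType) (P : dist R T).

Definition bias (f : T -> 'F_2) : R := \sum_x P x * F2_sign R (f x).

Lemma dmap_dprod_unif_bitE (g : T -> 'F_2) b c :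
  dmap (fun ux : 'F_2 * T => (ux.1, g ux.2)) (dprod (unif_bit R) P) (b, c) =
  2^-1 * \sum_x P x * (g x == c)%:R.
Proof.
rewrite dmapE -(pair_bigA _ (fun u x => dprod (unif_bit R) P (u, x)
  * ((u, g x) == (b, c))%:R)) (bigD1 b) //= [X in _ + X]big1 => [|u /negbTE ub].
  rewrite addr0 mulr_sumr; apply: eq_bigr => x _.
  by rewrite xpair_eqE eqxx mulrA.
by apply: big1 => x _; rewrite xpair_eqE ub mulr0.
Qed.

Lemma dmap_pair_sub_unif_bitE (f g : T -> 'F_2) b c :
  dmap (fun x => (f x, g x)) P (b, c)
  - dmap (fun ux : 'F_2 * T => (ux.1, g ux.2)) (dprod (unif_bit R) P) (b, c) =
  (F2_sign R b * bias f + F2_sign R (b + c) * bias (fun x => f x + g x)) / 4.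
Proof.
rewrite dmapE dmap_dprod_unif_bitE !mulr_sumr -sumrB -big_split mulr_suml /=.
apply: eq_bigr => x _; rewrite xpair_eqE -mulnb natrM !eq_F2E !F2_signD.
by field.
Qed.

Lemma stat_dist_unif_bit_le_bias (f g : T -> 'F_2) :
  stat_dist
    (dmap (fun x => (f x, g x)) P)
    (dmap (fun ux : 'F_2 * T => (ux.1, g ux.2)) (dprod (unif_bit R) P))
  <= (`|bias f| + `|bias (fun x => f x + g x)|) / 2.
Proof.
set e := (X in _ <= X).
apply: le_trans (_ : 2^-1 * \sum_(z : 'F_2 * 'F_2) e / 2 <= _); last first.
  by rewrite sumr_const card_prod card_Fp // -[_ *+ _]mulr_natr; lra.
apply: ler_wpM2l; first by rewrite invr_ge0.
apply: ler_sum => -[b c] _; rewrite dmap_pair_sub_unif_bitE normrM.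
rewrite [`|4^-1|]ger0_norm ?invr_ge0 // /e -mulrA -invfM -natrM.
apply: ler_wpM2r; first by rewrite invr_ge0.
by apply: le_trans (ler_normD _ _) _; rewrite !normrM !normr_F2_sign !mul1r.
Qed.

Lemma bias_uniform (A : {set T}) (f : T -> 'F_2) : uniform_over P A ->
  bias f = sign_sum R A f / #|A|%:R.
Proof.
move=> unifP; rewrite mulr_suml [RHS]big_mkcond; apply: eq_bigr => x _.
by rewrite unifP; case: ifP; rewrite ?mul0r // mulrC.
Qed.

End StatisticalDistance.

Definition cosh (R : realType) (t : R) : R := (expR t + expR (- t)) / 2.

Lemma cosh_ge0 (R : realType) (t : R) : 0 <= cosh t.
Proof. by rewrite divr_ge0 // addr_ge0 // expR_ge0. Qed.

Lemma cosh_le_expR (R : realType) (t : R) : cosh t <= expR (2 * t ^+ 2).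
Proof.
rewrite /cosh.
have [t_large|] := lerP 2^-1 `|t|.
  have expR_le (u : R) : `|u| = `|t| -> expR u <= expR (2 * t ^+ 2).
    move=> ut; rewrite ler_expR -(real_normK (num_real t)).
    by apply: le_trans (ler_norm u) _; rewrite ut; nra.
  by have := expR_le t erefl; have := expR_le (- t) (normrN t); lra.
rewrite ltr_norml => /andP[t_gt t_lt].
have expR_le (u : R) : u < 1 -> expR u <= (1 - u)^-1.
  move=> u_lt1; rewrite -[u in expR u]opprK expRN.
  by rewrite lef_pV2 ?posrE ?expR_gt0 ?subr_gt0 // expR_ge1Dx.
apply: le_trans (expR_ge1Dx _).
apply: le_trans (_ : ((1 - t)^-1 + (1 + t)^-1) / 2 <= _).
  have := expR_le t; have := expR_le (- t); rewrite opprK; lra.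
have sub_gt0 : 0 < 1 - t by lra.
have add_gt0 : 0 < 1 + t by lra.
have -> : ((1 - t)^-1 + (1 + t)^-1) / 2 = ((1 - t) * (1 + t))^-1.
  by field; rewrite !gt_eqF.
have t2_le : t ^+ 2 <= 2^-1 by nra.
have t2_ge0 := sqr_ge0 t.
by rewrite -div1r ler_pdivrMr ?mulr_gt0 //; nra.
Qed.

Section HoeffdingBound.
Variables (R : realType) (T : finType).
Implicit Types D : {set T}.

Lemma sum_expR_sign_sum D (t : R) :
  \sum_(f : {ffun T -> 'F_2}) expR (t * sign_sum R D f) =
  cosh t ^+ #|D| * #|{ffun T -> 'F_2}|%:R.
Proof.
pose w x b := if x \in D then expR (t * F2_sign R b) else 1.
transitivity (\sum_(f : {ffun T -> 'F_2}) \prod_x w x (f x)).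
  by apply: eq_bigr => f _; rewrite mulr_sumr expR_sum big_mkcond.
rewrite -bigA_distr_bigA card_ffun card_Fp // natrX mulrC.
rewrite -prodr_const [in RHS]big_mkcond /= -[in RHS]prodr_const -big_split /=.
apply: eq_bigr => x _; rewrite big_F2 /w F2_sign0 F2_sign1.
by case: ifP => _; rewrite ?mulr1 ?mulrN1 // /cosh; field.
Qed.

Lemma sum_expR_sign_sum_le D (m t : R) : #|D|%:R <= m ->
  \sum_(f : {ffun T -> 'F_2}) expR (t * sign_sum R D f) <=
  expR (2 * t ^+ 2 * m) * #|{ffun T -> 'F_2}|%:R.
Proof.
move=> leDm; rewrite sum_expR_sign_sum; apply: ler_wpM2r => //.
apply: le_trans (_ : expR (2 * t ^+ 2) ^+ #|D| <= _).
  by apply: lerXn2r (cosh_le_expR t); rewrite nnegrE ?expR_ge0 ?cosh_ge0.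
by rewrite -expRM_natr ler_expR ler_wpM2l // mulr_ge0 // sqr_ge0.
Qed.

Lemma card_large_sign_sum D (m delta : R) : #|D|%:R <= m -> 0 <= delta ->
  #|[set f : {ffun T -> 'F_2} | delta * m <= `|sign_sum R D f|]|%:R <=
  2 * expR (- (delta ^+ 2 * m / 8)) * #|{ffun T -> 'F_2}|%:R :> R.
Proof.
move=> leDm delta_ge0; set B := [set f | _].
(* This t minimizes the exponent [2 t^2 m - t delta m] of Markov's bound. *)
pose t := delta / 4.
have t_ge0 : 0 <= t by rewrite divr_ge0.
have markov : #|B|%:R * expR (t * (delta * m)) <=
    \sum_(f : {ffun T -> 'F_2})
      (expR (t * sign_sum R D f) + expR (- t * sign_sum R D f)).
  rewrite mulr_natl -sumr_const big_mkcond; apply: ler_sum => f _.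
  have pos_ge0 := expR_ge0 (t * sign_sum R D f).
  have neg_ge0 := expR_ge0 (- t * sign_sum R D f).
  case: ifP => [|_]; last exact: addr_ge0.
  rewrite inE ler_normr => /orP[] le_sum.
    by apply: ler_wpDr; rewrite // ler_expR ler_wpM2l.
  by apply: ler_wpDl; rewrite // ler_expR mulNr -mulrN ler_wpM2l.
have -> : - (delta ^+ 2 * m / 8) = 2 * t ^+ 2 * m - t * (delta * m).
  by rewrite /t; field.
rewrite expRD expRN mulrA mulrAC ler_pdivlMr ?expR_gt0 //.
apply: le_trans markov _.
rewrite big_split -[leRHS]mulrA [leRHS]mulr_natl [leRHS]mulr2n /=.
apply: lerD; first exact: sum_expR_sign_sum_le.
by rewrite -[t ^+ 2]sqrrN; apply: sum_expR_sign_sum_le.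
Qed.

End HoeffdingBound.

Section Decoupling.
Variables (T : finType) (D : {set T}) (g : {ffun T -> 'F_2} -> T -> 'F_2).

Definition determined_off : Prop :=
  forall f f' : {ffun T -> 'F_2}, {in ~: D, f =1 f'} -> {in D, g f =1 g f'}.

Definition shear (f : {ffun T -> 'F_2}) : {ffun T -> 'F_2} :=
  [ffun x => if x \in D then f x + g f x else f x].

Lemma shearK : determined_off -> involutive shear.
Proof.
move=> gD f; apply/ffunP => x; rewrite !ffunE; case: (boolP (x \in D)) => // xD.
rewrite (gD (shear f) f) // => [|y]; first by rewrite -addrA addrr_F2 addr0.
by rewrite inE ffunE => /negbTE ->.
Qed.

Lemma sign_sum_shear (R : realType) (f : {ffun T -> 'F_2}) :
  sign_sum R D (shear f) = sign_sum R D (fun x => f x + g f x).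
Proof. by apply: eq_bigr => x xD; rewrite ffunE xD. Qed.

End Decoupling.

Lemma union_bound (I T : finType) (B : I -> {set T}) :
  (\sum_i #|B i| < #|T|)%N -> exists x, forall i, x \notin B i.
Proof.
move=> ltT; have : (0 < #|~: \bigcup_i B i|)%N.
  rewrite cardsCs setCK subn_gt0; apply: leq_ltn_trans ltT.
  elim/big_rec2: _ => [|i n A _ leAn]; first by rewrite cards0.
  by apply: leq_trans (leq_card_setU _ _) _; rewrite leq_add2l.
move=> /card_gt0P[x]; rewrite inE => xB; exists x => i.
by apply: contra xB => xBi; apply/bigcupP; exists i.
Qed.

Lemma exists_small_sign_sums (R : realType) (T I : finType) (D : I -> {set T})
    (g : I -> {ffun T -> 'F_2} -> T -> 'F_2) (m : I -> R) (delta : R) :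
  0 <= delta -> (forall i, determined_off (D i) (g i)) ->
  (forall i, #|D i|%:R <= m i) ->
  \sum_i 2 * expR (- (delta ^+ 2 * m i / 8)) < 1 ->
  exists f : {ffun T -> 'F_2}, forall i,
    `|sign_sum R (D i) (fun x => f x + g i f x)| < delta * m i.
Proof.
move=> delta_ge0 gD leDm sum_lt1.
pose large i :=
  [set f : {ffun T -> 'F_2} | delta * m i <= `|sign_sum R (D i) f|].
have [|f fP] := @union_bound I _ (fun i => shear (D i) (g i) @^-1: large i).
  rewrite -(ltr_nat R) natr_sum -[ltRHS]mul1r.
  apply: le_lt_trans (_ : (\sum_i 2 * expR (- (delta ^+ 2 * m i / 8)))
    * #|{ffun T -> 'F_2}|%:R < _).
    rewrite mulr_suml; apply: ler_sum => i _.
    rewrite card_preimset; first exact: card_large_sign_sum.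
    exact: inv_inj (shearK (gD i)).
  by rewrite ltr_pM2r // ltr0n card_ffun card_Fp // expn_gt0.
by exists f => i; have := fP i; rewrite !inE -ltNge sign_sum_shear.
Qed.

Section Coloring.
Variables (T : finType) (h : T -> T).

Definition proper_coloring (U : eqType) (c : T -> U) : Prop :=
  forall x, c (h x) != c x.

Lemma exists_card_fiber_le1 (A : {set T}) : A != set0 ->
  exists2 x, x \in A & (#|[set y in A | h y == x]| <= 1)%N.
Proof.
rewrite -card_gt0 => A_gt0; apply/exists_inP; apply: contraLR A_gt0.
rewrite negb_exists_in -leqNgt => /forall_inP large_fiber.
have : (\sum_(x in A) #|[set y in A | h y == x]| <= #|A|)%N.
  rewrite -[leqRHS]sum1_card [leqRHS](bigID [pred y | h y \in A]) /=.
  apply: leq_trans (leq_addr _ _).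
  rewrite [leqRHS](partition_big h (mem A)) /= => [|y /andP[]//].
  apply: leq_sum => x xA; rewrite -sum1dep_card.
  by apply/eq_leq/eq_bigl => y; case: eqP => [->|]; rewrite ?xA ?andbT ?andbF.
have : (\sum_(x in A) 2 <= \sum_(x in A) #|[set y in A | h y == x]|)%N.
  by apply: leq_sum => x xA; rewrite ltnNge large_fiber.
by rewrite sum_nat_const; lia.
Qed.

(* Greedy coloring: a point with at most one preimage in A has at most two
   neighbors there. *)
Lemma exists_3coloring_in (A : {set T}) : (forall x, h x != x) ->
  exists c : {ffun T -> 'I_3},
    {in A, forall x, h x \in A -> c (h x) != c x}.
Proof.
move=> nofix; have [k] := ubnP #|A|; elim: k A => // k IH A.
have [->|/exists_card_fiber_le1[x0 x0A fiber_le1]] := eqVneq A set0.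
  by exists [ffun=> 0] => x; rewrite inE.
rewrite (cardsD1 x0) x0A add1n ltnS => /IH[c cP].
pose used := c (h x0) |: c @: [set y in A | h y == x0].
have : (0 < #|~: used|)%N.
  rewrite cardsCs setCK card_ord subn_gt0 cardsU1.
  have := leq_imset_card c [set y in A | h y == x0].
  by case: (_ \notin _) => /=; lia.
move=> /card_gt0P[col]; rewrite !inE negb_or => /andP[col_h col_fiber].
exists [ffun x => if x == x0 then col else c x] => x xA hxA; rewrite !ffunE.
have [->|x_neq] := eqVneq x x0; first by rewrite (negbTE (nofix x0)) eq_sym.
have [hx|hx_neq] := eqVneq (h x) x0; last by rewrite cP ?inE ?x_neq ?hx_neq.
by apply: contraNneq col_fiber => ->; apply: imset_f; rewrite inE xA hx /=.
Qed.

Lemma exists_proper_3coloring : (forall x, h x != x) ->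
  exists c : {ffun T -> 'I_3}, proper_coloring c.
Proof.
by move=> /(exists_3coloring_in setT)[c cP]; exists c => x; apply: cP.
Qed.

End Coloring.

Section NonMalleableExtractors.
Variables (R : realType) (T I J : finType).
Variables (S : I -> {set T}) (h : J -> T -> T) (K : nat).
Hypothesis S_large : forall i, (K <= #|S i|)%N.
Hypothesis h_nofix : forall j x, h j x != x.

(* [None] stands for an adversary that reveals nothing, so that the bias of f
   itself is one of the tests. *)
Definition tampered (f : {ffun T -> 'F_2}) (oj : option J) (x : T) : 'F_2 :=
  if oj is Some j then f (h j x) else 0.

Lemma tampered_determined_off (c : T -> 'I_3) (A : {set T}) oj k :
  (forall j, oj = Some j -> proper_coloring (h j) c) ->
  determined_off [set x in A | c x == k] (tampered^~ oj).
Proof.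
move=> cP f f' ff' x; rewrite inE => /andP[_ /eqP cx].
case: oj cP => //= j cP; apply: ff'.
by rewrite !inE -cx (negbTE (cP _ erefl x)) andbF.
Qed.

Lemma exists_tampering_coloring :
  exists c : option J -> {ffun T -> 'I_3},
    forall oj j, oj = Some j -> proper_coloring (h j) (c oj).
Proof.
apply: (@fin_all_exists _ (fun=> {ffun T -> 'I_3})
  (fun oj co => forall j, oj = Some j -> proper_coloring (h j) co)).
case=> [j|]; last by exists [ffun=> 0].
have [c cP] := exists_proper_3coloring (h_nofix j).
by exists c => _ [<-].
Qed.

Lemma sum_test_failures_lt1 (delta : R) :
  (6 * #|I| * #|J|.+1)%:R < expR (delta ^+ 2 * K%:R / 8) ->
  \sum_(i : I * option J * 'I_3)
    2 * expR (- (delta ^+ 2 * #|S i.1.1|%:R / 8)) < 1.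
Proof.
move=> few; apply: le_lt_trans (_ : \sum_(i : I * option J * 'I_3)
  2 * expR (- (delta ^+ 2 * K%:R / 8)) < 1).
  apply: ler_sum => i _; rewrite ler_pM2l // ler_expR lerN2.
  by rewrite ler_pM2r ?invr_gt0 // ler_wpM2l ?sqr_ge0 // ler_nat.
rewrite sumr_const !card_prod card_option card_ord -[_ *+ _]mulr_natl expRN.
rewrite mulrA -natrM ltr_pdivrMr ?expR_gt0 // mul1r.
by apply: le_lt_trans few; rewrite ler_nat; apply/eq_leq; ring.
Qed.

Lemma exists_small_tampered_sign_sums (delta : R) : 0 <= delta ->
  (6 * #|I| * #|J|.+1)%:R < expR (delta ^+ 2 * K%:R / 8) ->
  exists f : {ffun T -> 'F_2}, forall i oj,
    `|sign_sum R (S i) (fun x => f x + tampered f oj x)|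
    <= 3 * delta * #|S i|%:R.
Proof.
move=> delta_ge0 /sum_test_failures_lt1 sum_lt1.
have [c cP] := exists_tampering_coloring.
pose slice (i : I * option J * 'I_3) := [set x in S i.1.1 | c i.1.2 x == i.2].
have [i|i|f fP] := @exists_small_sign_sums R T _ slice
  (fun i => tampered^~ i.1.2) _ delta delta_ge0 _ _ sum_lt1.
- exact: tampered_determined_off (cP i.1.2).
- rewrite ler_nat subset_leq_card //.
  by apply/subsetP => x; rewrite inE => /andP[].
exists f => i oj; have := @normr_sign_sum_le_classes R T _ (c oj) (S i)
  (fun x => f x + tampered f oj x) (delta * #|S i|%:R).
by rewrite card_ord mulrA; apply=> k; apply/ltW/(fP (i, oj, k)).
Qed.

Lemma exists_nmext (eps : R) : 0 < eps ->
  (6 * #|I| * #|J|.+1)%:R < expR (eps ^+ 2 * K%:R / 72) ->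
  exists f : {ffun T -> 'F_2}, forall i (X : dist R T) j,
    uniform_over X (S i) ->
    stat_dist
      (dmap (fun x => (f x, f (h j x))) X)
      (dmap (fun ux : 'F_2 * T => (ux.1, f (h j ux.2))) (dprod (unif_bit R) X))
    <= eps.
Proof.
move=> eps_gt0 few.
have delta_ge0 : 0 <= eps / 3 by rewrite divr_ge0 // ltW.
have exponentE : eps ^+ 2 * K%:R / 72 = (eps / 3) ^+ 2 * K%:R / 8 by field.
rewrite exponentE in few.
have [f fP] := exists_small_tampered_sign_sums delta_ge0 few.
exists f => i X j unifX; apply: le_trans (stat_dist_unif_bit_le_bias _ _ _) _.
have bias_le oj : `|bias X (fun x => f x + tampered f oj x)| <= eps.
  rewrite (bias_uniform _ unifX) normrM [`|_^-1|]ger0_norm ?invr_ge0 //.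
  have [S0|S_gt0] := posnP #|S i|; first by rewrite S0 invr0 mulr0 ltW.
  rewrite ler_pdivrMr ?ltr0n //; apply: le_trans (fP i oj) _.
  by rewrite [3 * _]mulrC divfK ?pnatr_eq0.
have := bias_le None; have := bias_le (Some j); rewrite /= /bias.
under [in X in _ -> X -> _]eq_bigr => x _ do rewrite addr0.
lra.
Qed.

End NonMalleableExtractors.

Section FiniteVspace.
Import VectorInternalTheory.
Variables (F : finFieldType) (vT : vectType F).

HB.instance Definition _ := [Countable of {vspace vT} by <:].
HB.instance Definition _ := [Finite of {vspace vT} by <:].

Lemma card_vspaces_le : (#|{: {vspace vT}}| <= #|F| ^ (dim vT ^ 2))%N.
Proof. by rewrite -mulnn -card_mx; apply: leq_card (@vs2mx F vT) val_inj. Qed.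

End FiniteVspace.

Lemma card_affine_subspace n (a : 'cV['F_2]_n) (V : {vspace 'cV['F_2]_n}) :
  #|affine_subspace a V| = (2 ^ \dim V)%N.
Proof.
rewrite card_imset; last exact: addrI.
by rewrite card_vspace card_Fp.
Qed.

Lemma leq_expn_exp2_log2 (R : realType) (m n k : nat) : (0 < n)%N ->
  m%:R * log2 (n%:R : R) <= k%:R -> (n ^ m <= 2 ^ k)%N.
Proof.
move=> n_gt0; have ln2_gt0 : 0 < ln (2 : R) by apply: ln_gt0; lra.
rewrite mulrA ler_pdivrMr // !mulr_natl -!lnXn ?ltr0n //.
by rewrite ler_ln ?posrE ?exprn_gt0 ?ltr0n // -!natrX ler_nat.
Qed.

Lemma natr_exp2_le_expR (R : realType) (m : nat) : (2 ^ m)%:R <= expR m%:R :> R.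
Proof.
rewrite natrX -[m%:R]mul1r expRM_natr.
apply: lerXn2r; rewrite ?nnegrE ?expR_ge0 //.
exact: expR_ge1Dx.
Qed.

Lemma few_tests_lt_expR (R : realType) (eps : R) (n p q : nat) :
  0 < eps -> 24 / eps < n%:R ->
  (p <= 2 ^ (n ^ 2 + n))%N -> (q <= 2 ^ (n ^ 2 + n))%N ->
  (6 * p * q.+1)%:R < expR (eps ^+ 2 * (n ^ 4)%:R / 72).
Proof.
move=> eps_gt0 n_large le_p le_q.
have n_gt0 : 0 < n%:R :> R by apply: lt_trans n_large; apply: divr_gt0.
have few : (6 * p * q.+1 <= 2 ^ (8 * n ^ 2))%N.
  apply: leq_trans (_ : 2 ^ 3 * 2 ^ (n ^ 2 + n) * 2 ^ (n ^ 2 + n).+1 <= _)%N.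
    apply: leq_mul; first by apply: leq_mul.
    by rewrite expnS; have := expn_gt0 2 (n ^ 2 + n); lia.
  by rewrite -!expnD leq_exp2l //; move: n_gt0; rewrite ltr0n; nia.
apply: le_lt_trans (_ : (2 ^ (8 * n ^ 2))%:R < _); first by rewrite ler_nat.
apply: le_lt_trans (natr_exp2_le_expR _ _) _; rewrite ltr_expR natrM !natrX.
have -> : eps ^+ 2 * n%:R ^+ 4 / 72 = (n%:R * eps) ^+ 2 / 72 * n%:R ^+ 2.
  by field.
(* The constant 24 is chosen so that 24^2 / 72 = 8. *)
move: n_large; rewrite ltr_pdivrMr // => n_large.
by rewrite ltr_pM2r ?exprn_gt0 //; nra.
Qed.

Lemma card_affine_subspace_params n :
  (#|{: 'cV['F_2]_n * {vspace 'cV['F_2]_n}}| <= 2 ^ (n ^ 2 + n))%N.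
Proof.
rewrite card_prod card_mx card_Fp // muln1 expnD mulnC leq_pmul2r ?expn_gt0 //.
have dimE : dim 'cV['F_2]_n = n := muln1 n.
by have := card_vspaces_le 'cV['F_2]_n; rewrite card_Fp // dimE.
Qed.

Lemma card_affine_fun_params n :
  #|{: 'M['F_2]_n * 'cV['F_2]_n}| = (2 ^ (n ^ 2 + n))%N.
Proof. by rewrite card_prod !card_mx card_Fp // muln1 -expnD. Qed.

Lemma exists_affine_nmext (R : realType) (eps : R) (n : nat) :
  0 < eps -> 24 / eps < n%:R ->
  exists f : {ffun 'cV['F_2]_n -> 'F_2},
  forall (X : dist R 'cV['F_2]_n) (a : 'cV['F_2]_n) (V : {vspace 'cV['F_2]_n}),
    (n ^ 4 <= #|affine_subspace a V|)%N ->
    uniform_over X (affine_subspace a V) ->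
  forall (M : 'M['F_2]_n) (b : 'cV['F_2]_n), (forall x, M *m x + b != x) ->
  stat_dist
    (dmap (fun x => (f x, f (M *m x + b))) X)
    (dmap (fun ux : 'F_2 * 'cV['F_2]_n => (ux.1, f (M *m ux.2 + b)))
       (dprod (unif_bit R) X)) <= eps.
Proof.
move=> eps_gt0 n_large.
pose large (p : 'cV['F_2]_n * {vspace 'cV['F_2]_n}) :=
  (n ^ 4 <= #|affine_subspace p.1 p.2|)%N.
pose nofix (p : 'M['F_2]_n * 'cV['F_2]_n) := [forall x, p.1 *m x + p.2 != x].
have [|||f fP] := @exists_nmext R _ {p | large p} {p | nofix p}
  (fun i => affine_subspace (val i).1 (val i).2)
  (fun j x => (val j).1 *m x + (val j).2) (n ^ 4)%N _ _ eps eps_gt0.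
- by case.
- by move=> [p /= /forallP].
- apply: few_tests_lt_expR => //; rewrite card_sig.
    exact: leq_trans (max_card _) (card_affine_subspace_params n).
  by rewrite -card_affine_fun_params max_card.
exists f => X a V V_large unifX M b Mb_nofix.
have nofixMb : nofix (M, b) by apply/forallP.
exact: (fP (exist _ (a, V) V_large) X (exist _ (M, b) nofixMb) unifX).
Qed.

Theorem theorem6p3 (R : realType) (eps : R) (eps_gt0 : 0 < eps) :
  exists c : R, 1 < c /\
  exists N : nat, forall n : nat, (N <= n)%N ->
  exists anmExt : 'cV['F_2]_n -> 'F_2,
  forall k : nat, c * log2 (n%:R : R) <= k%:R ->
  forall (X : dist R 'cV['F_2]_n) (d : nat), affine_source X d -> (k <= d)%N ->
  forall A : 'cV['F_2]_n -> 'cV['F_2]_n,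
    affine_fun A -> (forall x, A x <> x) ->
  stat_dist
    (dmap (fun x => (anmExt x, anmExt (A x))) X)
    (dmap (fun ux : 'F_2 * 'cV['F_2]_n => (ux.1, anmExt (A ux.2)))
       (dprod (unif_bit R) X)) <= eps.
Proof.
exists 4%:R; split; first by rewrite ltr1n.
exists (Num.bound (24 / eps)) => n le_bound_n.
have n_large : 24 / eps < n%:R.
  apply: lt_le_trans (archi_boundP _) _; last by rewrite ler_nat.
  by rewrite divr_ge0 // ltW.
have n_gt0 : (0 < n)%N.
  by rewrite -(ltr0n R); apply: lt_trans n_large; apply: divr_gt0.
have [f fP] := exists_affine_nmext eps_gt0 n_large.
exists f => k /(@leq_expn_exp2_log2 _ 4 _ _ n_gt0) n4_le X d.
move=> [a [V [dimV unifX]]] le_kd A [M [b AE]] A_nofix.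
have -> : A = fun x => M *m x + b by apply/funext.
apply: fP unifX _ _ _ => [|x]; last by rewrite -AE; apply/eqP.
by rewrite card_affine_subspace dimV (leq_trans n4_le) ?leq_exp2l.
Qed.
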